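(* Let $\mathbb{C}$ be a regular equivalence distributive category. Then the trapezoid lemma holds in $\mathbb{C}$.
   Context: A category is regular if it has finite limits and coequalisers of kernel pairs, and regular epimorphisms are stable under pullback. A relation on an object $A$ is a subobject of $A\times A$, ordered by inclusion of subobjects; $\wedge$ is the meet of subobjects. Equivalence relations are internal ones (reflexive, symmetric, transitive), and $\mathsf{Eq}(A)$ denotes the meet semilattice of equivalence relations on $A$. A finitely complete category is equivalence distributive if, for every object $A$, $\mathsf{Eq}(A)$ is a distributive lattice (so joins exist in $\mathsf{Eq}(A)$, and $R\wedge (S\vee T) = (R\wedge S)\vee (R\wedge T)$ for all $R,S,T\in \mathsf{Eq}(A)$). For a relation $R$ on $A$ and morphisms $x,y\colon X\to A$ with a common domain, $xRy$ means that $(x,y)\colon X\to A\times A$ factors through a representative of $R$. A category $\mathbb{C}$ satisfies the trapezoid lemma if, for any three equivalence relations $R,S,T$ on any object $A$ of $\mathbb{C}$ with $R\wedge S\leqslant T$, and any morphisms $x,y,u,v$ with codomain $A$ and common domain such that $xSu$, $uTv$, $ySv$ and $xRy$, we have $xTy$. *)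

(* Defs.v *)
From Stdlib Require Import List FinFun.
Import ListNotations.

Set Implicit Arguments.
Unset Strict Implicit.
Unset Printing Implicit Defensive.

Record Category := {
  Ob :> Type;
  Hom : Ob -> Ob -> Type;
  idm : forall A, Hom A A;
  comp : forall A B D, Hom B D -> Hom A B -> Hom A D;
  comp_idl : forall A B (f : Hom A B), comp (idm B) f = f;
  comp_idr : forall A B (f : Hom A B), comp f (idm A) = f;
  comp_assoc : forall A B D E (h : Hom D E) (g : Hom B D) (f : Hom A B),
    comp h (comp g f) = comp (comp h g) f
}.

Arguments Hom {c} A B.
Arguments idm {c} A.
Arguments comp {c A B D} g f.

Declare Scope cat_scope.
Delimit Scope cat_scope with cat.
Local Open Scope cat_scope.
Notation "A ~> B" := (Hom A B) (at level 90, no associativity) : cat_scope.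
Notation "g ∘ f" := (comp g f) (at level 40, left associativity) : cat_scope.

Record Functor (J C : Category) := {
  fob :> J -> C;
  fmap : forall i j : J, (i ~> j) -> (fob i ~> fob j);
  fmap_id : forall i : J, fmap (idm i) = idm (fob i);
  fmap_comp : forall (i j k : J) (g : j ~> k) (f : i ~> j),
    fmap (g ∘ f) = fmap g ∘ fmap f
}.

Record Cone (J C : Category) (F : Functor J C) := {
  apex :> C;
  leg : forall i : J, apex ~> F i;
  leg_natural : forall (i j : J) (f : i ~> j), fmap F f ∘ leg i = leg j
}.

Record Limit (J C : Category) (F : Functor J C) := {
  lim_cone :> Cone F;
  lim_lift : forall K : Cone F, apex K ~> apex lim_cone;
  lim_fac : forall (K : Cone F) (i : J),
    leg lim_cone i ∘ lim_lift K = leg K i;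
  lim_unique : forall (K : Cone F) (h : apex K ~> apex lim_cone),
    (forall i : J, leg lim_cone i ∘ h = leg K i) -> h = lim_lift K
}.

Definition finite_category (J : Category) : Prop :=
  Finite J /\ forall i j : J, Finite (i ~> j).

(* Finite limits come with a choice of limit for each diagram, so that "A × A"
   below denotes a definite object; everything said about it is invariant
   under a change of this choice. *)
Record FinitelyCompleteCategory := {
  fc_cat :> Category;
  fc_lim : forall J : Category, finite_category J ->
    forall F : Functor J fc_cat, Limit F
}.

Definition is_pullback (C : Category) (A B D P : C)
    (f : A ~> D) (g : B ~> D) (p : P ~> A) (q : P ~> B) : Prop :=
  f ∘ p = g ∘ q /\
  forall (X : C) (a : X ~> A) (b : X ~> B), f ∘ a = g ∘ b ->
    exists! h : X ~> P, p ∘ h = a /\ q ∘ h = b.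

Definition is_kernel_pair (C : Category) (A B K : C)
    (f : A ~> B) (k1 k2 : K ~> A) : Prop :=
  is_pullback f f k1 k2.

Definition is_coequaliser (C : Category) (A B Q : C)
    (f g : A ~> B) (q : B ~> Q) : Prop :=
  q ∘ f = q ∘ g /\
  forall (X : C) (h : B ~> X), h ∘ f = h ∘ g ->
    exists! k : Q ~> X, k ∘ q = h.

Definition regular_epi (C : Category) (A B : C) (q : A ~> B) : Prop :=
  exists (K : C) (f g : K ~> A), is_coequaliser f g q.

Definition mono (C : Category) (A B : C) (m : A ~> B) : Prop :=
  forall (X : C) (f g : X ~> A), m ∘ f = m ∘ g -> f = g.

Record RegularCategory := {
  reg_fc :> FinitelyCompleteCategory;
  reg_coeq : forall (A B K : reg_fc) (f : A ~> B) (k1 k2 : K ~> A),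
    is_kernel_pair f k1 k2 ->
    exists (Q : reg_fc) (q : A ~> Q), is_coequaliser k1 k2 q;
  reg_stable : forall (A B D P : reg_fc)
      (f : A ~> D) (g : B ~> D) (p : P ~> A) (q : P ~> B),
    is_pullback f g p q -> regular_epi f -> regular_epi q
}.

Definition discrete_bool : Category.
Proof.
refine {| Ob := bool; Hom := fun a b => a = b; idm := fun a => eq_refl a;
          comp := fun a b d (g : b = d) (f : a = b) => eq_trans f g |}.
- intros a b f; destruct f; reflexivity.
- intros a b f; destruct f; reflexivity.
- intros a b d e h g f; destruct h, g, f; reflexivity.
Defined.

Lemma discrete_bool_finite : finite_category discrete_bool.
Proof.
split.
- exists [true; false]; intros [|]; simpl; auto.
- intros i j; simpl in i, j |- *.
  destruct (Bool.bool_dec i j) as [e|ne].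
  + exists [e]; intros e'; left; apply Eqdep_dec.UIP_dec, Bool.bool_dec.
  + exists []; intros e'; destruct (ne e').
Qed.

Definition pair_diagram (C : Category) (A B : C) : Functor discrete_bool C.
Proof.
refine (@Build_Functor discrete_bool C (fun b : bool => if b then A else B)
  (fun (i j : bool) (e : i = j) =>
     match e in _ = j' return
       (if i then A else B) ~> (if j' then A else B) with
     | eq_refl => idm (if i then A else B)
     end) _ _).
- reflexivity.
- intros i j k g f; simpl in *; destruct g, f; simpl.
  symmetry; apply comp_idl.
Defined.

Definition pair_cone (C : Category) (A B X : C) (x : X ~> A) (y : X ~> B) :
  Cone (pair_diagram A B).
Proof.
refine (@Build_Cone discrete_bool C (pair_diagram A B) X
  (fun b : bool =>
     if b return X ~> (if b then A else B) then x else y) _).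
intros i j f; simpl in *; destruct f; apply comp_idl.
Defined.

Section Products.
Variable C : FinitelyCompleteCategory.

Definition product_limit (A B : C) : Limit (pair_diagram A B) :=
  fc_lim discrete_bool_finite (pair_diagram A B).

Definition product (A B : C) : C := apex (product_limit A B).

Definition pr1 (A B : C) : product A B ~> A := leg (product_limit A B) true.

Definition pr2 (A B : C) : product A B ~> B := leg (product_limit A B) false.

Definition pairing (A B X : C) (x : X ~> A) (y : X ~> B) : X ~> product A B :=
  lim_lift (product_limit A B) (pair_cone x y).

Lemma pr1_pairing (A B X : C) (x : X ~> A) (y : X ~> B) :
  pr1 A B ∘ pairing x y = x.
Proof. exact (lim_fac (product_limit A B) (pair_cone x y) true). Qed.

Lemma pr2_pairing (A B X : C) (x : X ~> A) (y : X ~> B) :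
  pr2 A B ∘ pairing x y = y.
Proof. exact (lim_fac (product_limit A B) (pair_cone x y) false). Qed.

Lemma pairing_unique (A B X : C) (x : X ~> A) (y : X ~> B)
    (h : X ~> product A B) :
  pr1 A B ∘ h = x -> pr2 A B ∘ h = y -> h = pairing x y.
Proof.
intros h1 h2.
apply (@lim_unique _ _ _ (product_limit A B) (pair_cone x y) h).
intros [|]; assumption.
Qed.

End Products.

(* A subobject is handled through a representing monomorphism; two
   representatives denote the same subobject when each is below the other. *)
Record Relation (C : FinitelyCompleteCategory) (A : C) := {
  rel_ob : C;
  rel_map : rel_ob ~> product A A;
  rel_mono : mono rel_map
}.

Section Relations.
Variables (C : FinitelyCompleteCategory) (A : C).

Definition rel_le (R S : Relation A) : Prop :=
  exists h : rel_ob R ~> rel_ob S, rel_map S ∘ h = rel_map R.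

Definition rel_holds (R : Relation A) (X : C) (x y : X ~> A) : Prop :=
  exists h : X ~> rel_ob R, rel_map R ∘ h = pairing x y.

Definition rel_src (R : Relation A) : rel_ob R ~> A := pr1 A A ∘ rel_map R.

Definition rel_tgt (R : Relation A) : rel_ob R ~> A := pr2 A A ∘ rel_map R.

Definition rel_reflexive (R : Relation A) : Prop :=
  exists d : A ~> rel_ob R, rel_src R ∘ d = idm A /\ rel_tgt R ∘ d = idm A.

Definition rel_symmetric (R : Relation A) : Prop :=
  exists s : rel_ob R ~> rel_ob R,
    rel_src R ∘ s = rel_tgt R /\ rel_tgt R ∘ s = rel_src R.

Definition rel_transitive (R : Relation A) : Prop :=
  forall (P : C) (p q : P ~> rel_ob R),
    is_pullback (rel_tgt R) (rel_src R) p q ->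
    exists t : P ~> rel_ob R,
      rel_src R ∘ t = rel_src R ∘ p /\ rel_tgt R ∘ t = rel_tgt R ∘ q.

Record EqRel := {
  eq_rel :> Relation A;
  eq_refl_rel : rel_reflexive eq_rel;
  eq_sym_rel : rel_symmetric eq_rel;
  eq_trans_rel : rel_transitive eq_rel
}.

Definition eq_le (R S : EqRel) : Prop := rel_le R S.

End Relations.

Section Order.
Variables (X : Type) (le : X -> X -> Prop).

Definition is_meet (a b m : X) : Prop :=
  le m a /\ le m b /\ forall c, le c a -> le c b -> le c m.

Definition is_join (a b j : X) : Prop :=
  le a j /\ le b j /\ forall c, le a c -> le b c -> le j c.

(* For a preorder [le], read as the order on the quotient by mutual
   comparability: equality of elements is [le] in both directions. *)
Definition is_distributive_lattice : Prop :=
  (forall a b, exists m, is_meet a b m) /\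
  (forall a b, exists j, is_join a b j) /\
  (forall r s t st l rs rt j,
     is_join s t st -> is_meet r st l ->
     is_meet r s rs -> is_meet r t rt -> is_join rs rt j ->
     le l j /\ le j l).

End Order.

Definition equivalence_distributive (C : FinitelyCompleteCategory) : Prop :=
  forall A : C, is_distributive_lattice (@eq_le C A).

Definition trapezoid_lemma (C : FinitelyCompleteCategory) : Prop :=
  forall (A : C) (R S T : EqRel A) (M : Relation A),
    is_meet (@rel_le C A) R S M -> rel_le M T ->
    forall (X : C) (x y u v : X ~> A),
      rel_holds S x u -> rel_holds T u v -> rel_holds S y v ->
      rel_holds R x y -> rel_holds T x y.

(* Main.v *)
(* By distributivity R ∧ (S ∨ T) = (R ∧ S) ∨ (R ∧ T) ≤ T, and the hypotheses
   put (x, y) in R ∧ (S ∨ T).  The only construction needed is that meets in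
   Eq(A) are intersections of subobjects, so that generalised elements lying in
   both relations lie in their meet; this uses pullbacks. *)

Require Import Defs.
From Stdlib Require Import List.
Import ListNotations.
Local Open Scope cat_scope.

(* The cospan category is thin: [None] is the common target of [Some true] and
   [Some false]. *)
Definition cospan_le (i j : option bool) : bool :=
  match i, j with
  | _, None => true
  | Some a, Some b => Bool.eqb a b
  | None, Some _ => false
  end.

Definition cospan : Category.
Proof.
unshelve refine
  (@Build_Category (option bool)
     (fun i j => if cospan_le i j then unit else Empty_set) _ _ _ _ _).
- intros [[|]|]; exact tt.
- intros [[|]|] [[|]|] [[|]|]; simpl; intros g f;
    first [exact tt | destruct f; fail | destruct g; fail].
- intros [[|]|] [[|]|] f; destruct f; reflexivity.
- intros [[|]|] [[|]|] f; destruct f; reflexivity.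
- intros [[|]|] [[|]|] [[|]|] [[|]|] h g f;
    destruct h, g, f; reflexivity.
Defined.

Lemma cospan_finite : finite_category cospan.
Proof.
split.
- exists [Some true; Some false; None]; intros [[|]|]; simpl; auto.
- intros i j; simpl; destruct (cospan_le i j).
  + exists [tt]; intros []; simpl; auto.
  + exists []; intros [].
Qed.

Definition cospan_diagram (C : Category) (A B D : C) (f : A ~> D) (g : B ~> D) :
  Functor cospan C.
Proof.
unshelve refine (@Build_Functor cospan C
  (fun i : option bool =>
     match i with Some true => A | Some false => B | None => D end) _ _ _).
- intros [[|]|] [[|]|] e; simpl in e |- *;
    first [destruct e; fail | exact (idm _) | exact f | exact g].
- intros [[|]|]; reflexivity.
- intros [[|]|] [[|]|] [[|]|] b a; destruct b, a; simpl; symmetry;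
    first [apply comp_idl | apply comp_idr].
Defined.

Definition cospan_cone (C : Category) (A B D : C) (f : A ~> D) (g : B ~> D)
  (X : C) (a : X ~> A) (b : X ~> B) (e : f ∘ a = g ∘ b) :
  Cone (cospan_diagram C A B D f g).
Proof.
unshelve refine (@Build_Cone cospan C (cospan_diagram C A B D f g) X _ _).
- intros [[|]|]; [exact a | exact b | exact (f ∘ a)].
- intros [[|]|] [[|]|] h; destruct h; simpl;
    first [apply comp_idl | reflexivity | symmetry; exact e].
Defined.

(** A pullback is the limit over [cospan], with the leg at [None] left out because naturality
    determines it. *)
Lemma pullback_exists (C : FinitelyCompleteCategory) (A B D : C)
    (f : A ~> D) (g : B ~> D) :
  exists (P : C) (p : P ~> A) (q : P ~> B), is_pullback f g p q.
Proof.
set (F := cospan_diagram C A B D f g).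
set (L := fc_lim cospan_finite F).
pose proof (@leg_natural _ _ _ L (Some true) None tt) as nf.
pose proof (@leg_natural _ _ _ L (Some false) None tt) as ng.
simpl in nf, ng.
exists (apex L), (leg L (Some true)), (leg L (Some false)); split.
- exact (eq_trans nf (eq_sym ng)).
- intros X a b e.
  set (K := cospan_cone C A B D f g X a b e).
  exists (lim_lift L K); split.
  + split; [exact (lim_fac L K (Some true)) | exact (lim_fac L K (Some false))].
  + intros h [ha hb]; symmetry; apply (@lim_unique _ _ _ L K h).
    intros [[|]|]; [exact ha | exact hb |].
    (* The leg at [None] is [f] after the leg at [Some true], so this equation follows from [ha]. *)
    change (leg L None ∘ h = f ∘ a).
    rewrite <- nf, <- ha, <- comp_assoc; reflexivity.
Qed.

Section GeneralisedElements.
Variables (C : FinitelyCompleteCategory) (A : C).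

(** Trades factorisation through the product for two component equations, the form in which the
    axioms of an equivalence relation are given. *)
Lemma rel_holdsP (R : Relation A) (X : C) (x y : X ~> A) :
  rel_holds R x y <->
  exists h : X ~> rel_ob R, rel_src R ∘ h = x /\ rel_tgt R ∘ h = y.
Proof.
unfold rel_src, rel_tgt; split; intros [h e]; exists h.
- now rewrite <- !comp_assoc, e, pr1_pairing, pr2_pairing.
- rewrite <- !comp_assoc in e; destruct e; now apply pairing_unique.
Qed.

Lemma rel_holds_generic (R : Relation A) : rel_holds R (rel_src R) (rel_tgt R).
Proof. apply rel_holdsP; exists (idm _); now rewrite !comp_idr. Qed.

Lemma rel_holds_comp (R : Relation A) (X Y : C) (x y : X ~> A) (f : Y ~> X) :
  rel_holds R x y -> rel_holds R (x ∘ f) (y ∘ f).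
Proof.
rewrite !rel_holdsP; intros [h [<- <-]].
exists (h ∘ f); now rewrite !comp_assoc.
Qed.

Lemma rel_holds_le (R S : Relation A) (X : C) (x y : X ~> A) :
  rel_le R S -> rel_holds R x y -> rel_holds S x y.
Proof.
intros [k ek] [h eh]; exists (k ∘ h); now rewrite comp_assoc, ek.
Qed.

Lemma rel_holds_refl (R : EqRel A) (X : C) (x : X ~> A) : rel_holds R x x.
Proof.
destruct (eq_refl_rel R) as [d [d1 d2]].
apply rel_holdsP; exists (d ∘ x).
now rewrite !comp_assoc, d1, d2, comp_idl.
Qed.

Lemma rel_holds_sym (R : EqRel A) (X : C) (x y : X ~> A) :
  rel_holds R x y -> rel_holds R y x.
Proof.
destruct (eq_sym_rel R) as [s [s1 s2]].
rewrite !rel_holdsP; intros [h [<- <-]]; exists (s ∘ h).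
now rewrite !comp_assoc, s1, s2.
Qed.

(** The two factorisations agree at [y], so they induce a map into the pullback of composable pairs,
    where internal transitivity applies. *)
Lemma rel_holds_trans (R : EqRel A) (X : C) (x y z : X ~> A) :
  rel_holds R x y -> rel_holds R y z -> rel_holds R x z.
Proof.
rewrite !rel_holdsP; intros [h [<- eh]] [k [ek <-]].
destruct (pullback_exists C _ _ _ (rel_tgt R) (rel_src R)) as [P [p [q pb]]].
destruct (@eq_trans_rel _ _ R P p q pb) as [t [t1 t2]].
destruct (proj2 pb X h k (eq_trans eh (eq_sym ek))) as [w [[<- <-] _]].
exists (t ∘ w); now rewrite !comp_assoc, t1, t2.
Qed.

(** The intersection is the pullback of the two representing monomorphisms. *)
Lemma intersection_exists (R S : Relation A) :
  exists M : Relation A, forall (X : C) (x y : X ~> A),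
    rel_holds M x y <-> rel_holds R x y /\ rel_holds S x y.
Proof.
destruct (pullback_exists C _ _ _ (rel_map R) (rel_map S)) as [P [p [q [e u]]]].
assert (m : mono (rel_map R ∘ p)).
{ intros X f g E.
  assert (E1 : p ∘ f = p ∘ g).
  { apply (@rel_mono _ _ R); now rewrite !comp_assoc. }
  assert (E2 : q ∘ f = q ∘ g).
  { apply (@rel_mono _ _ S); now rewrite !comp_assoc, <- e. }
  assert (E3 : rel_map R ∘ (p ∘ g) = rel_map S ∘ (q ∘ g)).
  { now rewrite !comp_assoc, e. }
  (* Both [f] and [g] mediate for this one cone, so uniqueness identifies them. *)
  destruct (u X (p ∘ g) (q ∘ g) E3) as [w [_ uw]].
  now rewrite <- (uw f (conj E1 E2)), <- (uw g (conj eq_refl eq_refl)). }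
exists {| rel_ob := P; rel_map := rel_map R ∘ p; rel_mono := m |}.
intros X x y; unfold rel_holds; simpl; split.
- intros [h eh]; split.
  + exists (p ∘ h); now rewrite comp_assoc.
  + exists (q ∘ h); now rewrite comp_assoc, <- e.
- intros [[h eh] [k ek]].
  destruct (u X h k (eq_trans eh (eq_sym ek))) as [w [[w1 _] _]].
  exists w; now rewrite <- comp_assoc, w1.
Qed.

(** A Yoneda argument: the hypothesis at the generic pair of [R], whose pairing is [rel_map R]
    itself, yields the factorisation. *)
Lemma rel_le_holds (R S : Relation A) :
  (forall (X : C) (x y : X ~> A), rel_holds R x y -> rel_holds S x y) ->
  rel_le R S.
Proof.
intros H; destruct (H _ _ _ (rel_holds_generic R)) as [h eh].
exists h; rewrite eh; symmetry; now apply pairing_unique.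
Qed.

(** Each axiom, read on generalised elements, passes from [R] and [S] to their intersection. *)
Lemma eq_intersection_exists (R S : EqRel A) :
  exists M : EqRel A, forall (X : C) (x y : X ~> A),
    rel_holds M x y <-> rel_holds R x y /\ rel_holds S x y.
Proof.
destruct (intersection_exists R S) as [M HM].
assert (Mr : rel_reflexive M).
{ apply rel_holdsP, HM; split; apply rel_holds_refl. }
destruct (proj1 (HM _ _ _) (rel_holds_generic M)) as [gR gS].
assert (Ms : rel_symmetric M).
{ apply rel_holdsP, HM; split; now apply rel_holds_sym. }
assert (Mt : rel_transitive M).
{ intros P p q [e _]; apply rel_holdsP, HM; split;
    (* The middle element is the common value of the pullback square, also equal to
       [rel_src M ∘ q]. *)
    apply rel_holds_trans with (rel_tgt M ∘ p);
    first [now apply rel_holds_comp | rewrite e; now apply rel_holds_comp]. }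
now exists {| eq_rel := M; eq_refl_rel := Mr; eq_sym_rel := Ms;
              eq_trans_rel := Mt |}.
Qed.

(** [M] is a greatest lower bound among equivalence relations only. The intersection is itself an
    equivalence relation, hence lies below [M]. *)
Lemma rel_holds_meet (R S M : EqRel A) (X : C) (x y : X ~> A) :
  is_meet (@eq_le C A) R S M ->
  rel_holds R x y -> rel_holds S x y -> rel_holds M x y.
Proof.
intros [_ [_ glb]] r s.
destruct (eq_intersection_exists R S) as [N HN].
apply rel_holds_le with N; [|now apply HN].
apply glb; apply rel_le_holds; intros Z a b n; now apply HN in n.
Qed.

End GeneralisedElements.

Theorem proposition3p2 (C : RegularCategory) :
  equivalence_distributive C -> trapezoid_lemma C.
Proof.
intros dist A R S T M [_ [_ glb]] MT X x y u v xu uv yv xy.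
destruct (dist A) as [meets [joins distr]].
destruct (joins S T) as [ST jST].
destruct (meets R ST) as [L mL].
destruct (meets R S) as [RS mRS].
destruct (meets R T) as [RT mRT].
destruct (joins RS RT) as [J jJ].
destruct (distr _ _ _ _ _ _ _ _ jST mL mRS mRT jJ) as [LJ _].
destruct jST as [S_le [T_le _]].
assert (xyL : rel_holds L x y).
{ apply (rel_holds_meet _ _ _ _ _ _ _ _ mL xy).
  (* The chain [x] S [u] T [v] S [y] lies in the join [ST]. *)
  apply rel_holds_trans with u; [now apply (rel_holds_le _ _ S)|].
  apply rel_holds_trans with v; [now apply (rel_holds_le _ _ T)|].
  apply rel_holds_sym; now apply (rel_holds_le _ _ S). }
apply (rel_holds_le _ _ J); [|now apply (rel_holds_le _ _ L)].
apply jJ; [|apply mRT].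
apply rel_le_holds; intros Z a b ab.
(* [RS] is a meet in Eq(A) and [M] a meet among all relations; as a lower bound of [R] and [S], [RS]
   lies below [M], hence below [T]. *)
apply (rel_holds_le _ _ M); [exact MT|].
apply (rel_holds_le _ _ RS); [apply glb; apply mRS | exact ab].
Qed.
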